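(* Let $\omega=\omega(M)\to\infty$. (i) Let $G$ be a $d$-dimensional infinite grid ($d\ge1$) or another infinite Cayley graph, and let $t$ be such that $t\ge \omega M^2 R(2t)$, where $R(2t)$ is the expected number of returns to the origin in $2t$ steps of a simple random walk on $G$. Then with probability at least $1-1/\omega$, the dispersion process with $M$ particles started at a single vertex of $G$ terminates within $t$ process steps. (ii) Let $G=(V,E)$ be the hypercube on $n=2^d$ vertices or another finite Cayley graph on $n$ vertices; let $n'=n/2$ if $G$ is bipartite and $n'=n$ otherwise; let $P$ be the transition matrix of simple random walk on $G$, and let $T$ be such that for all even $s\ge T$ and all $u\in V$, $|P^s(u,u)-1/n'|\le 1/(2n')$. Then with probability at least $1-1/\omega$, the dispersion process with $M=o(\sqrt{n/\omega})$ particles started at a single vertex terminates within $t=O(TM^2)$ process steps.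
   Context: Cayley graphs here are Cayley graphs of Abelian groups with respect to a symmetric generating set $S$ (if $g\in S$ then $-g\in S$): vertices are group elements and $u$ is adjacent to $u+g$ for $g\in S$; simple random walk moves from $u$ to $u+g$ with $g$ uniform in $S$. The dispersion process: $M$ particles start at one origin vertex; synchronously at each step, at each vertex occupied by more than one particle at the start of the step, each of these particles moves independently to a uniformly random neighbour; a particle alone at a vertex does not move. The process terminates at the first step where every vertex holds at most one particle. *)

(* Defs.v *)
(* MathComp + MathComp-Analysis *)
From HB Require Import structures.
From mathcomp Require Import all_boot all_order all_algebra finmap.
From mathcomp Require Import all_classical all_reals all_analysis.

Set Implicit Arguments.
Unset Strict Implicit.
Unset Printing Implicit Defensive.

Import Order.TTheory GRing.Theory Num.Theory.

Local Open Scope fset_scope.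
Local Open Scope ring_scope.

Definition mean (R : realType) (Omega : finType) (f : Omega -> R) : R :=
  (\sum_w f w) / #|Omega|%:R.

(* Uniform probability measure on a finite sample space. *)
Definition prob (R : realType) (Omega : finType) (A : pred Omega) : R :=
  mean (fun w => (A w)%:R).

(* The Cayley graph of the Abelian group V with respect to S joins u to u + g
   for every g \in S. *)
Definition symmetric_set (V : zmodType) (S : {fset V}) : Prop :=
  forall g, g \in S -> - g \in S.

Definition generating_set (V : zmodType) (S : {fset V}) : Prop :=
  forall H : {pred V}, zmod_closed H -> {subset S <= H} -> forall v, v \in H.

Definition is_cayley (V : zmodType) (S : {fset V}) : Prop :=
  symmetric_set S /\ generating_set S.

(* Position after s steps of the walk from o whose successive increments are
   g; simple random walk of length k is this walk for uniform g : k.-tuple S. *)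
Definition walk (V : zmodType) (S : {fset V}) (o : V) (g : seq S) (s : nat)
  : V := o + \sum_(x <- take s g) val x.

(* Time 0 is not counted as a return. *)
Definition returns (V : zmodType) (S : {fset V}) (o : V) (k : nat)
    (g : k.-tuple S) : nat :=
  \sum_(1 <= s < k.+1) (walk o g s == o).

Definition expected_returns (R : realType) (V : zmodType) (S : {fset V})
    (o : V) (k : nat) : R :=
  mean (fun g : k.-tuple S => (returns o g)%:R).

(* A configuration x : {ffun 'I_M -> V} gives the vertex of each particle. *)
Definition occupancy (V : zmodType) (M : nat) (x : {ffun 'I_M -> V}) (v : V)
  : nat := #|[set i | x i == v]|.

Definition dispersed (V : zmodType) (M : nat) (x : {ffun 'I_M -> V}) : bool :=
  `[< forall v, (occupancy x v <= 1)%N >].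

(* g i is the move proposed to particle i; it is ignored when i is alone. *)
Definition dispersion_step (V : zmodType) (S : {fset V}) (M : nat)
    (x : {ffun 'I_M -> V}) (g : {ffun 'I_M -> S}) : {ffun 'I_M -> V} :=
  [ffun i => if (1 < occupancy x (x i))%N then x i + val (g i) else x i].

Definition dispersion (V : zmodType) (S : {fset V}) (M : nat) (o : V)
    (g : seq {ffun 'I_M -> S}) (s : nat) : {ffun 'I_M -> V} :=
  foldl (@dispersion_step V S M) [ffun=> o] (take s g).

(* Whether termination occurs within t steps depends only on the first t steps
   of the process, so the sample space below (independent uniform moves for
   each particle and each of t steps) carries the exact probability. *)
Definition prob_terminates_within (R : realType) (V : zmodType) (S : {fset V})
    (M : nat) (o : V) (t : nat) : R :=
  prob R (fun g : t.-tuple {ffun 'I_M -> S} =>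
    [exists s : 'I_t.+1, dispersed (dispersion o g s)]).

(* Rows and columns are indexed by V through its canonical enumeration. *)
Definition transition_matrix (R : realType) (V : finZmodType) (S : {fset V})
  : 'M[R]_#|V| :=
  \matrix_(i, j) ((enum_val j - enum_val i \in S)%:R / #|` S|%:R).

Definition step_prob (R : realType) (V : finZmodType) (S : {fset V}) (s : nat)
    (u v : V) : R :=
  (transition_matrix R S ^+ s) (enum_rank u) (enum_rank v).

Definition bipartite (V : finZmodType) (S : {fset V}) : bool :=
  [exists c : {ffun V -> bool},
    [forall u, forall v, (v - u \in S) ==> (c u != c v)]].

Definition effective_size (R : realType) (V : finZmodType) (S : {fset V}) : R :=
  if bipartite S then #|V|%:R / 2 else #|V|%:R.

Definition return_mixing (R : realType) (V : finZmodType) (S : {fset V})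
    (T : nat) : Prop :=
  let n' := effective_size R S in
  forall s : nat, ~~ odd s -> (T <= s)%N ->
  forall u : V, `|step_prob R S s u u - n'^-1| <= (2 * n')^-1.

(* Main.v *)
(** The difference of the positions of two particles is a simple random walk run
at the clock N counting the moves of the two particles: N advances by 0, 1 or 2
at each step, and by 2 whenever the particles share a vertex.  Hence a pair
shares a vertex at most T times while N <= T, and the expected number of times
it does so with N > T during the first t steps is at most the expected number of
visits to 0 of the walk at times in (T, 2t].  If the process has not terminated
within t steps then at each of the times 1, ..., t some pair shares a vertex, so
Markov's inequality gives
  (t - M^2 T) P(not terminated) <= M^2 sum_(T < m <= 2t) P^m(0, 0).
For (i) take T = 0.  For (ii) take t = 2 T M^2 and use P^m(0, 0) <= 3 / n for
m > T, where odd times reduce to even ones because P^(2k)(0, v) is maximal at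
v = 0. *)
Require Import Defs.
From HB Require Import structures.
From mathcomp Require Import all_boot all_order all_algebra finmap.
From mathcomp Require Import all_classical all_reals all_analysis.
From mathcomp Require Import ring lra zify.

Set Implicit Arguments.
Unset Strict Implicit.
Unset Printing Implicit Defensive.

Import Order.TTheory GRing.Theory Num.Theory.
Import numFieldNormedType.Exports.

Local Open Scope classical_set_scope.
Local Open Scope ring_scope.

(** * Uniform averages over finite sample spaces *)

Section Mean.
Variables (R : realType) (Omega : finType).
Implicit Types f g : Omega -> R.

Lemma eq_mean f g : f =1 g -> mean f = mean g.
Proof. by move=> fg; rewrite /mean (eq_bigr _ (fun w _ => fg w)). Qed.

Lemma ler_mean f g : (forall w, f w <= g w) -> mean f <= mean g.
Proof.
by move=> fg; apply: ler_wpM2r; [rewrite invr_ge0 | apply: ler_sum].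
Qed.

Lemma mean_ge0 f : (forall w, 0 <= f w) -> 0 <= mean f.
Proof. by move=> f0; rewrite divr_ge0 ?sumr_ge0. Qed.

Lemma meanD f g : mean (fun w => f w + g w) = mean f + mean g.
Proof. by rewrite /mean big_split mulrDl. Qed.

Lemma meanZ a f : mean (fun w => a * f w) = a * mean f.
Proof. by rewrite /mean -mulr_sumr mulrA. Qed.

Lemma mean_sum (I : Type) (r : seq I) (P : pred I) (F : I -> Omega -> R) :
  mean (fun w => \sum_(i <- r | P i) F i w) = \sum_(i <- r | P i) mean (F i).
Proof. by rewrite /mean exchange_big mulr_suml. Qed.

Lemma mean_const (a : R) : (0 < #|Omega|)%N -> mean (fun _ : Omega => a) = a.
Proof.
move=> O0; rewrite /mean.
have -> : \sum_(w : Omega) a = a * #|Omega|%:R.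
  by rewrite mulr_natr -sumr_const.
by rewrite mulfK // pnatr_eq0 -lt0n.
Qed.

End Mean.

Lemma mean_reindex (R : realType) (A B : finType) (h : A -> B) (f : B -> R) :
  bijective h -> mean (fun a => f (h a)) = mean f.
Proof.
move=> bh; rewrite /mean (reindex h) ?(bij_eq_card bh) //.
exact: onW_bij.
Qed.

Lemma mean_pair (R : realType) (A B : finType) (f : A -> B -> R) :
  mean (fun a => mean (f a)) = mean (fun p : A * B => f p.1 p.2).
Proof.
rewrite /mean -mulr_suml card_prod natrM invfM [_^-1 * _^-1]mulrC mulrA.
by rewrite (pair_big predT predT).
Qed.

Lemma mean_cons (R : realType) (A : finType) (n : nat)
    (f : n.+1.-tuple A -> R) :
  mean f = mean (fun x => mean (fun w : n.-tuple A => f (cons_tuple x w))).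
Proof.
rewrite mean_pair.
rewrite -(mean_reindex (h := fun p => cons_tuple p.1 p.2)) //.
exists (fun w => (thead w, [tuple of behead w])) => [[x w]|w] /=.
  by congr pair; apply: val_inj.
by apply: val_inj; rewrite /= [in RHS](tuple_eta w).
Qed.

Lemma mean_ffun2 (R : realType) (I J : finType) (i j : I) (h : J -> J -> R) :
  (0 < #|J|)%N -> i != j ->
  mean (fun g : {ffun I -> J} => h (g i) (g j))
  = mean (fun a => mean (h a)).
Proof.
move=> J0 ij; have J0' : #|J|%:R != 0 :> R by rewrite pnatr_eq0 -lt0n.
(* The indicator factors over the coordinates: [i] and [j] contribute 1 each, every other coordinate
   contributes [#|J|]. *)
have cnt a b : \sum_(g : {ffun I -> J}) ((g i == a) && (g j == b))%:R
    = #|J|%:R ^+ #|I| / #|J|%:R ^+ 2 :> R.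
  pose F k c : R := if k == i then (c == a)%:R else
                    if k == j then (c == b)%:R else 1.
  transitivity (\sum_(g : {ffun I -> J}) \prod_k F k (g k)).
    apply: eq_bigr => g _.
    rewrite (bigD1 i) // (bigD1 j) 1?eq_sym //= big1 => [|k /andP[ki kj]].
      by rewrite /F !eqxx (negbTE (_ : j != i)) 1?eq_sym // mulr1 -mulnb natrM.
    by rewrite /F (negbTE ki) (negbTE kj).
  rewrite -bigA_distr_bigA (bigD1 i) // (bigD1 j) 1?eq_sym //=.
  have sum1 c : \sum_(x : J) (x == c)%:R = 1 :> R.
    by rewrite (bigD1 c) //= eqxx big1 ?addr0 // => x /negbTE ->.
  have -> : \sum_x F i x = 1 by rewrite /F eqxx sum1.
  have -> : \sum_x F j x = 1.
    by rewrite /F (negbTE (_ : j != i)) 1?eq_sym // eqxx sum1.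
  rewrite !mul1r (eq_bigr (fun=> #|J|%:R)) => [|k /andP[ki kj]]; last first.
    by rewrite /F (negbTE ki) (negbTE kj) sumr_const.
  rewrite prodr_const.
  have -> : #|I| = (#|[pred k | (k != i) && (k != j)]| + 2)%N.
    rewrite (cardD1 i) (cardD1 j) !inE eq_sym ij /= addnA addnC.
    by congr (_ + _)%N; apply: eq_card => k; rewrite !inE andbT andbC.
  by rewrite exprD mulfK // expf_neq0.
transitivity (mean (fun g : {ffun I -> J} =>
    \sum_a \sum_b h a b * ((g i == a) && (g j == b))%:R)).
  apply: eq_mean => g; rewrite (bigD1 (g i)) //= (bigD1 (g j)) //= !eqxx mulr1.
  rewrite big1 => [|b /negbTE bj]; last by rewrite eq_sym bj mulr0.
  rewrite big1 => [|a /negbTE ai]; first by rewrite !addr0.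
  by rewrite big1 // => b _; rewrite eq_sym ai mulr0.
rewrite mean_pair /mean card_prod card_ffun exchange_big /=.
rewrite -(pair_big predT predT h) /= mulr_suml [RHS]mulr_suml.
apply: eq_bigr => a _; rewrite exchange_big mulr_suml [RHS]mulr_suml.
apply: eq_bigr => b _; rewrite -mulr_sumr cnt natrM natrX.
have : #|J|%:R ^+ #|I| != 0 :> R by rewrite expf_neq0.
by move: (_ ^+ #|I|) => z z0; field; rewrite J0' z0.
Qed.

(* [zero_prob R S k d] is the probability that k uniform steps from S lead
   from d to 0. *)
Fixpoint zero_prob (R : realType) (V : zmodType) (S : {fset V}) (k : nat)
    (d : V) : R :=
  if k is k'.+1 then mean (fun g : S => zero_prob R S k' (d + val g))
  else (d == 0)%:R.

(** * Simple random walk and its visits to 0 *)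

Section Walk.
Variables (R : realType) (V : zmodType) (S : {fset V}).
Hypothesis S0 : (0 < #|{: S}|)%N.
Implicit Types (d o : V) (k n : nat).

Local Notation p := (zero_prob R S).

Lemma zero_prob_ge0 k d : 0 <= p k d.
Proof. by elim: k d => [|k IH] d /=; [case: eqP | apply: mean_ge0]. Qed.

Lemma mean_walk o d s k : (s <= k)%N ->
  mean (fun g : k.-tuple S => (walk d g s == o)%:R) = p s (d - o).
Proof.
have c0 n : (0 < #|{: n.-tuple S}|)%N by rewrite card_tuple expn_gt0 S0.
elim: s d k => [|s IH] d [|k] //= sk.
1,2: rewrite (eq_mean (g := fun=> (d == o)%:R)) ?mean_const ?subr_eq0 // => g;
      by rewrite /walk take0 big_nil addr0.
rewrite mean_cons; apply: eq_mean => x.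
rewrite [in RHS]addrAC -(IH _ k) //; apply: eq_mean => g.
by rewrite /walk /= big_cons addrA.
Qed.

Lemma expected_returnsE o k :
  expected_returns R S o k = \sum_(1 <= s < k.+1) p s 0.
Proof.
rewrite /expected_returns.
under eq_mean do rewrite /returns natr_sum.
rewrite mean_sum big_nat [RHS]big_nat; apply: eq_bigr => s /andP[_ sk].
by rewrite mean_walk // subrr.
Qed.

(** Negation permutes [S]; hence the move of the second particle of a pair, which enters the
    difference with a minus sign, acts as an ordinary step. *)
Lemma mean_opp (f : V -> R) : symmetric_set S ->
  mean (fun g : S => f (- val g)) = mean (fun g : S => f (val g)).
Proof.
move=> symS; pose opp (g : S) : S := FSetSub (symS _ (valP g)).
have bij_opp : bijective opp.
  by exists opp => g; apply: val_inj; rewrite /= opprK.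
by rewrite -(mean_reindex (fun g => f (val g)) bij_opp).
Qed.

(* Expected number of visits to 0 of a walk started at d, during k further
   steps, when n steps have been made before and only visits after step T are
   counted. *)
Definition late_visits (T n k : nat) (d : V) : R :=
  \sum_(m < k) (T < n + m.+1)%:R * p m.+1 d.

Lemma late_visits_ge0 T n k d : 0 <= late_visits T n k d.
Proof. by apply: sumr_ge0 => m _; rewrite mulr_ge0 ?zero_prob_ge0. Qed.

Lemma late_visits_le T n k d : late_visits T n k d <= late_visits T n k.+1 d.
Proof.
by rewrite /late_visits big_ord_recr lerDl mulr_ge0 ?zero_prob_ge0.
Qed.

(** First-step decomposition: a step advances the clock [n] and uses up one of the remaining
    steps. *)
Lemma late_visitsS T n k d :
  mean (fun g : S => (T < n.+1)%:R * (d + val g == 0)%:R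
                     + late_visits T n.+1 k (d + val g))
  = late_visits T n k.+1 d.
Proof.
rewrite /late_visits big_ord_recl meanD mean_sum meanZ addn1; congr (_ + _).
by apply: eq_bigr => m _; rewrite meanZ addSnnS.
Qed.

End Walk.

(** * Collisions of pairs in the dispersion process *)

Section Dispersion.
Variables (V : zmodType) (S : {fset V}) (M : nat).
Implicit Types (x : {ffun 'I_M -> V}) (g : {ffun 'I_M -> S}) (i j : 'I_M).

Definition moves x i : bool := (1 < occupancy x (x i))%N.

(* Along the run from x driven by gs, the number of positive times at which i
   and j share a vertex after having made more than T moves between them;
   n is the number of moves they had made before. *)
Fixpoint collisions (T : nat) (i j : 'I_M) x (n : nat)
    (gs : seq {ffun 'I_M -> S}) : nat :=
  if gs is g :: gs' then
    let x' := dispersion_step x g in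
    let n' := (n + moves x i + moves x j)%N in
    ((T < n') && (x' i == x' j) + collisions T i j x' n' gs')%N
  else 0.

Lemma dispersion_stepE x g i :
  dispersion_step x g i = x i + (if moves x i then val (g i) else 0).
Proof. by rewrite ffunE /moves; case: ifP; rewrite ?addr0. Qed.

Lemma moves_eq x i j : i != j -> x i = x j -> moves x i.
Proof.
move=> ij xij; apply/card_gt1P; exists i, j.
by rewrite !inE xij !eqxx ij.
Qed.

Lemma dispersedPn x :
  ~~ dispersed x -> exists i, exists2 j, j != i & x i = x j.
Proof.
move=> /asboolPn /existsNP[v] /negP; rewrite -ltnNge.
move=> /card_gt1P[i [j [xi xj ij]]].
by exists i, j; rewrite 1?eq_sym //; move: xi xj; rewrite !inE => /eqP-> /eqP->.
Qed.

(* Each early collision of a pair is preceded by a move of the pair, so there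
   are at most T of them. *)
Lemma collisions_all T i j x n gs : i != j ->
  (collisions 0 i j x n gs <= collisions T i j x n gs + (T - n))%N.
Proof.
move=> ij; elim: gs x n => //= g gs IH x n.
set x' := dispersion_step x g; set n' := (n + _ + _)%N.
have nn' : x' i == x' j -> (n < n')%N.
  move=> /eqP; rewrite !dispersion_stepE /n'.
  case mi: (moves x i); first by rewrite addn1; lia.
  case mj: (moves x j); first by lia.
  by rewrite !addr0 => /(moves_eq ij); rewrite mi.
have := IH x' n'; have : (n <= n')%N by rewrite /n'; lia.
case: (x' i == x' j) nn' => [/(_ isT)|_]; rewrite ?andbT ?andbF /=; last by lia.
by case: (ltnP T n'); case: (ltnP 0 n') => /=; lia.
Qed.

(** At threshold 0 the clock test is automatic: if neither of two particles meeting after a step had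
    moved, they would have shared a vertex before it, and so moved. The clocks [n] are arbitrary so
    that the induction can advance them. *)
Lemma undispersed_collisions x gs :
  (forall s, (0 < s <= size gs)%N ->
     ~~ dispersed (foldl (@dispersion_step V S M) x (take s gs))) ->
  forall n : 'I_M -> 'I_M -> nat,
  (size gs <= \sum_i \sum_(j | j != i) collisions 0 i j x (n i j) gs)%N.
Proof.
elim: gs x => //= g gs IH x nd n.
have /dispersedPn[i [j ji xij]] := nd 1%N isT; rewrite /= take0 /= in xij.
pose n' a b := (n a b + moves x a + moves x b)%N.
have {}IH : (size gs <= \sum_i \sum_(j | j != i)
    collisions 0 i j (dispersion_step x g) (n' i j) gs)%N.
  by apply: IH => s /andP[s0 sg]; apply: (nd s.+1); rewrite /= ltnS.
under eq_bigr do rewrite big_split.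
rewrite big_split -add1n; apply: leq_add => //.
rewrite (bigD1 i) //= (bigD1 j) //= xij eqxx andbT -addnA.
rewrite ltn_addr // -/(n' i j).
suff -> : (0 < n' i j)%N by [].
rewrite /n'; case mi : (moves x i); first by lia.
case mj : (moves x j); first by lia.
move: xij; rewrite !dispersion_stepE mi mj !addr0 => xij.
by have := moves_eq _ xij; rewrite eq_sym ji mi => /(_ isT).
Qed.

Variable R : realType.
Hypothesis S0 : (0 < #|{: S}|)%N.
Hypothesis symS : symmetric_set S.

(* The difference of the positions of i and j performs a simple random walk,
   observed at some of its times only. *)
Lemma mean_collisions T i j x n t : i != j ->
  mean (fun gs : t.-tuple {ffun 'I_M -> S} =>
    (collisions T i j x n gs)%:R : R)
  <= late_visits R S T n t.*2 (x i - x j).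
Proof.
move=> ij; elim: t x n => [|t IH] x n.
  rewrite (eq_mean (g := fun=> 0)) => [|g]; last by rewrite tuple0.
  by rewrite mean_const ?card_tuple ?expn0 ?late_visits_ge0.
have F0 : (0 < #|{: t.-tuple {ffun 'I_M -> S}}|)%N.
  by rewrite card_tuple card_ffun !expn_gt0 S0.
set n' := (n + moves x i + moves x j)%N; set k := t.*2 in IH *.
(* [W d] bounds the expected collisions from this step on, given the new difference [d]; [D a b] is
   that difference for proposed moves [a] and [b]. *)
pose W d := (T < n')%:R * (d == 0)%:R + late_visits R S T n' k d.
pose D (a b : V) := x i - x j + (if moves x i then a else 0)
                     - (if moves x j then b else 0).
apply: (@le_trans _ _ (mean (fun g : {ffun 'I_M -> S} =>
    W (D (val (g i)) (val (g j)))))).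
  rewrite mean_cons; apply: ler_mean => g /=; rewrite -/n'.
  under eq_mean do rewrite natrD.
  rewrite meanD mean_const //; set x' := dispersion_step x g.
  have -> : D (val (g i)) (val (g j)) = x' i - x' j.
    by rewrite /x' !dispersion_stepE /D opprD addrACA addrA.
  by rewrite /W subr_eq0 -mulnb natrM lerD2l IH.
rewrite (mean_ffun2 (fun a b : S => W (D (val a) (val b)))) //.
rewrite {}/W {}/D {}/n' doubleS -/k.
have le2 d : late_visits R S T n k d <= late_visits R S T n k.+2 d.
  by apply: le_trans (late_visits_le _ _ _ _ _ _) _; exact: late_visits_le.
case mi: (moves x i); case mj: (moves x j); rewrite ?addn0 ?addn1.
- rewrite -late_visitsS; apply: ler_mean => a.
  rewrite (mean_opp (fun b => (T < n.+2)%:R * (x i - x j + val a + b == 0)%:R +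
    late_visits R S T n.+2 k (x i - x j + val a + b))) //.
  by rewrite late_visitsS lerDr mulr_ge0.
- apply: le_trans (late_visits_le _ _ _ _ _ _).
  rewrite -late_visitsS; apply: ler_mean => a.
  by rewrite mean_const // subr0.
- rewrite mean_const //.
  apply: le_trans (late_visits_le _ _ _ _ _ _).
  rewrite (mean_opp (fun b => (T < n.+1)%:R * (x i - x j + 0 + b == 0)%:R +
    late_visits R S T n.+1 k (x i - x j + 0 + b))) //.
  by rewrite late_visitsS addr0.
- rewrite !mean_const // addr0 subr0 subr_eq0.
  case: eqP => [/(moves_eq ij)|_]; first by rewrite mi.
  by rewrite mulr0 add0r.
Qed.

Lemma prob_terminates_ge o T t :
  (t%:R - (M ^ 2 * T)%:R) * (1 - prob_terminates_within R S M o t)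
  <= M%:R ^+ 2 * \sum_(T.+1 <= m < t.*2.+1) zero_prob R S m 0.
Proof.
set x0 : {ffun 'I_M -> V} := [ffun=> o].
have F0 : (0 < #|{: t.-tuple {ffun 'I_M -> S}}|)%N.
  by rewrite card_tuple card_ffun !expn_gt0 S0.
pose X (gs : t.-tuple {ffun 'I_M -> S}) : R :=
  \sum_i \sum_(j | j != i) (collisions T i j x0 0 gs)%:R.
have EX : mean X <= M%:R ^+ 2 * late_visits R S T 0 t.*2 0.
  rewrite mean_sum expr2 -mulrA.
  have -> (a : R) : M%:R * a = \sum_(i < M) a.
    by rewrite sumr_const card_ord mulr_natl.
  apply: ler_sum => i _; rewrite mean_sum.
  have -> (a : R) : M%:R * a = \sum_(i < M) a.
    by rewrite sumr_const card_ord mulr_natl.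
  rewrite [leRHS](bigID (fun j => j != i)) /= -[leLHS]addr0; apply: lerD.
    apply: ler_sum => j ji; apply: le_trans (mean_collisions _ _ _ _ _) _.
      by rewrite eq_sym.
    by rewrite !ffunE subrr.
  by apply: sumr_ge0 => *; exact: late_visits_ge0.
have -> : \sum_(T.+1 <= m < t.*2.+1) zero_prob R S m 0
          = late_visits R S T 0 t.*2 0.
  rewrite (big_nat_widenl _ 1) // big_mkcond big_add1 big_mkord.
  by apply: eq_bigr => m _ /=; rewrite add0n; case: ltnP; rewrite ?mul1r ?mul0r.
apply: le_trans EX.
set c := t%:R - _.
have -> : c * (1 - prob_terminates_within R S M o t) =
  mean (fun gs : t.-tuple {ffun 'I_M -> S} =>
    c + - c * [exists s : 'I_t.+1, dispersed (dispersion o gs s)]%:R).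
  by rewrite meanD meanZ mean_const // -/(prob _ _) mulNr mulrBr mulr1.
(* Markov's inequality pointwise: [c] times the indicator of nontermination is at most [X], whatever
   the sign of [c]. *)
apply: ler_mean => gs; case: existsP => [_|nd].
  by rewrite mulr1 subrr; apply: sumr_ge0 => i _; apply: sumr_ge0.
rewrite mulr0 addr0 lerBlDr /X.
under eq_bigr do rewrite -natr_sum.
rewrite -natr_sum -natrD ler_nat.
rewrite -[leqLHS](size_tuple gs).
apply: leq_trans (undispersed_collisions (x := x0) _ (fun _ _ => 0%N)) _.
  rewrite size_tuple => s /andP[_ st]; apply/negP => ds.
  by apply: nd; exists (Ordinal (st : (s < t.+1)%N)).
rewrite addnC -leq_subLR.
(* Each ordered pair receives its own [T], to be compared with its early collisions; the diagonal
   shares are surplus. *)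
have -> : (M ^ 2 * T = \sum_(i < M) \sum_(j < M) T)%N.
  by rewrite !sum_nat_const card_ord mulnA.
rewrite leq_subLR -big_split /=; apply: leq_sum => i _.
rewrite [X in (_ <= X + _)%N](bigID (fun j => j != i)) /= -addnA addnCA addnC.
apply: leq_trans (leq_addr _ _); rewrite -big_split /=.
apply: leq_sum => j ji.
by rewrite addnC -[T in (_ + T)%N]subn0 collisions_all // eq_sym.
Qed.

End Dispersion.

(** * Return probabilities on finite groups *)

Section FiniteGroup.
Variables (R : realType) (V : finZmodType) (S : {fset V}).
Hypothesis S0 : (0 < #|{: S}|)%N.
Hypothesis symS : symmetric_set S.

Local Notation p := (zero_prob R S).

Lemma step_prob0 k u : step_prob R S k u 0 = p k u.
Proof.
elim: k u => [|k IH] u; rewrite /step_prob.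
  by rewrite expr0 mxE (inj_eq enum_rank_inj).
rewrite exprS mxE (reindex (@enum_rank V)); last exact/onW_bij/enum_rank_bij.
under eq_bigr => v _ do rewrite mxE !enum_rankK -/(step_prob R S k v 0) IH.
rewrite (reindex_inj (addrI u)) /= /mean mulr_suml -cardfE.
under eq_bigr => v _ do rewrite addrAC subrr add0r mulrAC.
rewrite -(big_seq_fsetE _ S xpredT (fun v => p k (u + v) / #|` S|%:R)) /=.
rewrite [RHS]big_uniq ?fset_uniq //= [RHS]big_mkcond; apply: eq_bigr => v _.
by case: (v \in S); rewrite ?mul1r ?mul0r.
Qed.

(** Chapman-Kolmogorov, split at the vertex [w] reached after [a] steps; translation invariance
    turns going from [d] to [w] into going from [d - w] to 0. *)
Lemma zero_probD a b d : p (a + b) d = \sum_w p a (d - w) * p b w.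
Proof.
elim: a d => [|a IH] d.
  rewrite (bigD1 d) //= subrr eqxx mul1r big1 ?addr0 // => w wd.
  by rewrite subr_eq0 eq_sym (negbTE wd) mul0r.
rewrite addSn /=; under eq_mean do rewrite IH.
rewrite mean_sum; apply: eq_bigr => w _.
rewrite mulrC -meanZ; apply: eq_mean => g.
by rewrite mulrC addrAC.
Qed.

Lemma zero_probN k d : p k (- d) = p k d.
Proof.
elim: k d => [|k IH] d /=; first by rewrite oppr_eq0.
rewrite -(mean_opp (fun b => p k (d + b))) //; apply: eq_mean => g.
by rewrite -IH opprD opprK.
Qed.

(* AM-GM applied to sum_w p k (d - w) * p k w. *)
Lemma zero_prob_even_max k d : p (k + k) d <= p (k + k) 0.
Proof.
have sq : p (k + k) 0 = \sum_w p k w ^+ 2.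
  by rewrite zero_probD; apply: eq_bigr => w _; rewrite sub0r zero_probN expr2.
have sq' : p (k + k) 0 = \sum_w p k (d - w) ^+ 2.
  by rewrite sq (reindex_inj (subrI d)).
suff : 2 * p (k + k) d <= p (k + k) 0 + p (k + k) 0 by lra.
rewrite {1}sq' sq -big_split zero_probD mulr_sumr; apply: ler_sum => w _ /=.
rewrite -subr_ge0; set a := p k _; set b := p k _.
have -> : a ^+ 2 + b ^+ 2 - 2 * (a * b) = (a - b) ^+ 2 by ring.
exact: sqr_ge0.
Qed.

(** Mixing gives [3 / (2 * n')], and [n'] is at least half of [#|V|]. *)
Lemma zero_prob_mixing_even T k : return_mixing R S T ->
  ~~ odd k -> (T <= k)%N -> p k 0 <= 3 / #|V|%:R.
Proof.
move=> mix ek Tk; have := mix k ek Tk 0; rewrite step_prob0 ler_distl.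
move=> /andP[_ /le_trans]; apply; rewrite /effective_size.
have : 0 <= #|V|%:R^-1 :> R by rewrite invr_ge0.
by case: bipartite; rewrite !invfM ?invrK; lra.
Qed.

Lemma zero_prob_mixing T k :
  return_mixing R S T -> (T < k)%N -> p k 0 <= 3 / #|V|%:R.
Proof.
move=> mix Tk; have even_le := zero_prob_mixing_even mix.
case: (boolP (odd k)) => [ok|/even_le]; last by apply; exact: ltnW.
(* An odd time is one step followed by an even number [k] of steps; the strict bound on the odd time
   leaves [T <= k]. *)
case: k ok Tk => //= k ek Tk.
rewrite -[leRHS](mean_const _ S0); apply: ler_mean => g.
apply: le_trans (even_le k ek Tk).
by rewrite -(odd_double_half k) (negbTE ek) add0n -addnn zero_prob_even_max.
Qed.

End FiniteGroup.

(** * Termination bounds on finite and infinite Cayley graphs *)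

(** An empty [S] generates only the subgroup 0. Nonemptiness keeps [mean] away from division by
    zero. *)
Lemma generating_set_neq0 (V : zmodType) (S : {fset V}) (v : V) :
  generating_set S -> v != 0 -> (0 < #|{: S}|)%N.
Proof.
move=> genS v0; rewrite lt0n; apply: contra v0 => /eqP cS.
apply: (genS (pred1 0)) => [|u uS].
  by split=> [|a b]; rewrite !inE // => /eqP-> /eqP->; rewrite subrr.
by have := card0_eq cS (FSetSub uS); rewrite inE.
Qed.

Lemma finite_prob_terminates (R : realType) (V : finZmodType) (S : {fset V})
    (M T : nat) (o : V) (w : R) :
  is_cayley S -> return_mixing R S T -> (0 < M)%N -> 1 <= w ->
  M%:R <= 4^-1 * Num.sqrt (#|V|%:R / w) ->
  1 - w^-1 <= prob_terminates_within R S M o (2 * (T * M ^ 2)).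
Proof.
move=> [symS genS] mix M1 w1 sm.
set n : R := #|V|%:R in sm *; set m : R := M%:R in sm *.
have w0 : 0 < w by lra.
have m1 : 1 <= m by rewrite ler1n.
(* Squaring the ratio 1/4 gives 16, which exceeds the 12 in the failure bound [12 * m ^+ 2 / n]
   reached below. *)
have n16 : 16 * (w * m ^+ 2) <= n.
  have nw0 : 0 <= n / w by rewrite divr_ge0 ?ler0n // ltW.
  have : (4 * m) ^+ 2 <= Num.sqrt (n / w) ^+ 2.
    by rewrite ler_sqr ?nnegrE ?sqrtr_ge0 //; lra.
  by rewrite sqr_sqrtr // ler_pdivlMr // => ?; nra.
have m2 : 1 <= m ^+ 2 by rewrite exprn_ege1.
have wm1 : 1 <= w * m ^+ 2 by nra.
have [v v0] : exists v : V, v != 0.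
  have : (1 < #|V|)%N by rewrite -(ltr_nat R) -/n; lra.
  move=> /card_gt1P[a [b [_ _ ab]]].
  by exists (a - b); rewrite subr_eq0.
have S0 := generating_set_neq0 genS v0.
(* For [T = 0], mixing at time 0 would give [1 <= 3 / n], against [16 <= n]. *)
have T0 : (0 < T)%N.
  rewrite lt0n; apply/eqP => T0; rewrite T0 in mix.
  have /= := zero_prob_mixing_even mix (k := 0) isT (leqnn 0).
  by rewrite eqxx mulr1n -/n ler_pdivlMr; lra.
set a := (T * M ^ 2)%N.
have Ta : (T <= a)%N by rewrite leq_pmulr ?expn_gt0 ?M1.
have a0 : 0 < a%:R :> R by rewrite ltr0n muln_gt0 T0 expn_gt0 M1.
have := prob_terminates_ge M R S0 symS o T (2 * a).
set P := prob_terminates_within _ _ _ _ _; rewrite [(M ^ 2 * T)%N]mulnC -/a.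
(* With [t = 2 * a] the clock runs to at most [4 * a], and every term past [T] is at most
   [3 / n]. *)
have : \sum_(T.+1 <= j < (2 * a).*2.+1) zero_prob R S j 0 <= 4 * a%:R * (3 / n).
  apply: (@le_trans _ _ (\sum_(0 <= j < (2 * a).*2) 3 / n)); last first.
    rewrite big_const_nat subn0 iter_addr addr0.
    by rewrite -[leLHS]mulr_natl -mul2n mulnA (natrM _ (2 * 2) a).
  rewrite big_add1 [leRHS](big_cat_nat (n := T)) //=; last by lia.
  rewrite -[leLHS]add0r lerD ?sumr_ge0 // => [j _|]; first by rewrite divr_ge0.
  apply: ler_sum_nat => j /andP[Tj _].
  exact: (@zero_prob_mixing R V S S0 symS T j.+1).
set E := \sum_(_ <= _ < _) _ => Ele.
have -> : (2 * a)%:R - a%:R = a%:R :> R by rewrite natrM; ring.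
move=> aP; have {aP} : a%:R * (1 - P) <= a%:R * (12 * m ^+ 2 / n).
  apply: le_trans aP _; rewrite -/m.
  have -> : a%:R * (12 * m ^+ 2 / n) = m ^+ 2 * (4 * a%:R * (3 / n)) by ring.
  by rewrite ler_wpM2l // sqr_ge0.
rewrite ler_pM2l // => aP; rewrite lerBlDr -lerBlDl; apply: le_trans aP _.
have n0 : 0 < n by lra.
by rewrite -[leRHS]div1r ler_pdivlMr // mulrAC ler_pdivrMr //; lra.
Qed.

Theorem theorem3 (R : realType) (omega : nat -> R)
    (homega : omega m @[m --> \oo] --> +oo) :
  (forall (V : zmodType) (S : {fset V}),
     infinite_set [set: V] -> is_cayley S ->
     forall (o : V) (M t : nat), 0 < omega M -> (0 < t)%N ->
       omega M * M%:R ^+ 2 * expected_returns R S o (2 * t) <= t%:R ->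
       1 - (omega M)^-1 <= prob_terminates_within R S M o t)
  /\
  (exists C : nat,
   forall (V : nat -> finZmodType) (S : forall k, {fset V k}) (M T : nat -> nat),
     (forall k, is_cayley (S k)) ->
     M k @[k --> \oo] --> \oo ->
     (fun k => (M k)%:R : R^o)
       =o_\oo (fun k => Num.sqrt (#|V k|%:R / omega (M k)) : R^o) ->
     (forall k, return_mixing R (S k) (T k)) ->
     \forall k \near \oo, forall o : V k,
       1 - (omega (M k))^-1
         <= prob_terminates_within R (S k) (M k) o (C * (T k * M k ^ 2))).
Proof.
split.
  move=> V S Vinf [symS genS] o M t w0 t0.
  have [v v0] : exists v : V, v != 0.
    apply: contrapT => /forallNP all0; apply: Vinf.
    suff -> : [set: V] = [set 0] by exact: finite_set1.
    apply/seteqP; split => v // _ /=; apply/eqP.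
    by apply: contrapT => /negP; exact: all0.
  have S0 := generating_set_neq0 genS v0.
  have := prob_terminates_ge M R S0 symS o 0 t.
  rewrite expected_returnsE // mul2n muln0 subr0; set E := \sum_(_ <= _ < _) _.
  set P := prob_terminates_within _ _ _ _ _ => tP wE.
  rewrite lerBlDr -lerBlDl -div1r ler_pdivlMr //.
  rewrite -(ler_pM2l (_ : 0 < t%:R)) ?ltr0n //.
  rewrite mulr1 mulrA; apply: le_trans wE.
  by rewrite mulrC -mulrA ler_pM2l.
exists 2%N => V S M T cay Moo lo mix.
have w_ge1 : \forall k \near \oo, 1 <= omega (M k).
  exact: (cvgryPge _).1 (cvg_comp _ _ Moo homega) 1.
have M_ge : \forall k \near \oo, (1 <= M k)%N by exact: (cvgnyPge _).1 Moo 1%N.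
(* The little-o hypothesis at the ratio 1/4 that [finite_prob_terminates] asks for. *)
have small : \forall k \near \oo,
    `|(M k)%:R| <= 4^-1 * `|Num.sqrt (#|V k|%:R / omega (M k))|.
  by move/eqoP: lo; apply; lra.
near=> k => o.
have w1 : 1 <= omega (M k) by near: k.
have M1 : (1 <= M k)%N by near: k.
have : `|(M k)%:R| <= 4^-1 * `|Num.sqrt (#|V k|%:R / omega (M k))|.
  by near: k.
rewrite !ger0_norm ?sqrtr_ge0 ?ler0n //; exact: finite_prob_terminates.
Unshelve. all: by end_near.
Qed.
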